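(* Let $t\ge2$, $N=t+2$, $\lambda$ a partition with at most $N$ parts, and $\Phi_t(\lambda;z)=s_\lambda(1,\zeta,\dots,\zeta^{t-1},z,z^{-1})$ with $\zeta=e^{2\pi i/t}$. Then $\Phi_t(\lambda;z)\equiv0$ (identically in $z$) if and only if some residue class modulo $t$ contains no element of $\beta(\lambda)$, or (no class being empty) $a_1+a_2=b_1+b_2$. In particular, if one residue class contains exactly three elements of $\beta(\lambda)$ and every other class exactly one, then $\Phi_t(\lambda;z)\not\equiv0$.
   Context: For $\lambda=(\lambda_1\ge\dots\ge\lambda_N\ge0)$ the beta set is $\beta(\lambda)=\{\beta_1>\dots>\beta_N\ge0\}$ with $\beta_j=\lambda_j+N-j$. Let $n_i$ be the number of $\beta_j\equiv i\pmod t$, so $\sum_{i=0}^{t-1}n_i=t+2$. If no class is empty, then either exactly two classes have $n_i=2$ (all others $1$), or exactly one has $n_i=3$ (all others $1$). In the first case let $r_A<r_B$ be the residues of the two classes of size two and let $A=\{a_1>a_2\}$, $B=\{b_1>b_2\}$ be the elements of $\beta(\lambda)$ in classes $r_A$, $r_B$. In the second case, if the class of size three is $\{p>q>r\}$, let $A=\{a_1>a_2\}=\{p,q\}$ and $B=\{b_1>b_2\}=\{q,r\}$. $s_\lambda$ denotes the Schur polynomial. *)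

(* Defs.v *)
From mathcomp Require Import all_boot all_order all_algebra perm.
From mathcomp Require Import complex mpoly.
From mathcomp Require Import reals trigo.

Set Implicit Arguments.
Unset Strict Implicit.
Unset Printing Implicit Defensive.

Import GRing.Theory.
Local Open Scope ring_scope.

(* A partition with at most n parts is a weakly decreasing n-tuple of natural
   numbers, padded by zeros.  Indices start at 0, so beta lam j below is
   lambda_(j+1) + n - (j+1). *)
Definition beta n (lam : n.-tuple nat) (j : 'I_n) : nat :=
  (tnth lam j + (n - j.+1))%N.

(* For a partition lam this list is strictly decreasing. *)
Definition beta_class t n (lam : n.-tuple nat) (r : 'I_t) : seq nat :=
  [seq b <- [seq beta lam j | j <- enum 'I_n] | (b %% t == r)%N].

Definition alternant (R : idomainType) n (b : 'I_n -> nat) : {mpoly R[n]} :=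
  \det (\matrix_(i < n, j < n) ('X_i : {mpoly R[n]}) ^+ b j).

Definition staircase n (j : 'I_n) : nat := (n - j.+1)%N.

(* Divide 'X^m by the monic polynomial with roots x_i and evaluate at x_i. *)
Lemma expr_staircase (A : comNzRingType) n (x : 'I_n -> A) :
  exists c : nat -> 'I_n -> A,
    forall m i, x i ^+ m = \sum_(k < n) c m k * x i ^+ staircase k.
Proof.
pose P : {poly A} := \prod_(i < n) ('X - (x i)%:P).
have Pm : P \is monic by apply: monic_prod_XsubC.
have sP : size P = n.+1.
  by rewrite /P size_prod_XsubC /index_enum -enumT size_enum_ord.
pose c m := Pdiv.CommonRing.rmodp 'X^m P.
exists (fun m k => (c m)`_(staircase k)) => m i.
have szc : (size (c m) <= n)%N.
  by rewrite -ltnS -sP Pdiv.CommonRing.ltn_rmodpN0 // monic_neq0.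
have P0 : P.[x i] = 0.
  by rewrite /P horner_prod (bigD1 i) //= hornerXsubC subrr mul0r.
transitivity ((c m).[x i]).
  rewrite -hornerXn {1}(Pdiv.RingMonic.rdivp_eq Pm 'X^m).
  by rewrite hornerD hornerM P0 mulr0 add0r.
by rewrite (horner_coef_wide _ szc) (reindex_inj rev_ord_inj).
Qed.

Lemma schur_exists (R : idomainType) n (lam : n.-tuple nat) :
  exists s : {mpoly R[n]},
    s * alternant R (@staircase n) == alternant R (beta lam).
Proof.
have [c cE] := expr_staircase (fun i : 'I_n => 'X_i : {mpoly R[n]}).
exists (\det (\matrix_(k < n, j < n) c (beta lam j) k)).
rewrite mulrC -det_mulmx; apply/eqP; congr (\det _).
apply/matrixP => i j; rewrite !mxE cE; apply: eq_bigr => k _.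
by rewrite !mxE mulrC.
Qed.

(* The Schur polynomial s_lam(x_1,...,x_n): the quotient of
   det(x_i ^ (lam_j + n - j)) by the Vandermonde determinant det(x_i ^ (n - j)),
   as an element of the polynomial ring. *)
Definition schur (R : idomainType) n (lam : n.-tuple nat) : {mpoly R[n]} :=
  xchoose (schur_exists R lam).

Lemma schurE (R : idomainType) n (lam : n.-tuple nat) :
  schur R lam * alternant R (@staircase n) = alternant R (beta lam).
Proof. exact/eqP/(xchooseP (schur_exists R lam)). Qed.

Lemma alternant_staircase_neq0 (R : idomainType) n :
  alternant R (@staircase n) != 0.
Proof.
pose a : 'rV[{mpoly R[n]}]_n := \row_i 'X_i.
have E : \matrix_(i < n, j < n) ('X_i : {mpoly R[n]}) ^+ staircase j =
         col_perm (perm rev_ord_inj) (Vandermonde n a)^T.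
  by apply/matrixP => i j; rewrite !mxE permE.
rewrite /alternant E col_permE det_mulmx det_tr det_perm det_Vandermonde.
rewrite mulf_neq0 ?signr_eq0 //.
apply/prodf_neq0 => i _; apply/prodf_neq0 => j ltij; rewrite !mxE subr_eq0.
apply/eqP => /(congr1 (mcoeff U_(i))); rewrite !mcoeffX eqxx.
case: eqP => [/(congr1 (fun m : 'X_{1..n} => m i))|_ /eqP].
  by rewrite !mnmE eqxx; case: eqP => // e; rewrite e ltnn in ltij.
by rewrite eq_sym oner_eq0.
Qed.

Lemma schur_uniq (R : idomainType) n (lam : n.-tuple nat) (s : {mpoly R[n]}) :
  s * alternant R (@staircase n) = alternant R (beta lam) -> s = schur R lam.
Proof.
by rewrite -(schurE R lam); apply: mulIf; apply: alternant_staircase_neq0.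
Qed.

Definition zeta (R : realType) (t : nat) : R[i] :=
  (cos (2 * pi / t%:R) +i* sin (2 * pi / t%:R))%C.

(* The point (1, zeta, ..., zeta^(t-1), z, z^-1). *)
Definition Phi_point (R : realType) (t : nat) (z : R[i]) (j : 'I_t.+2) : R[i] :=
  if (j < t)%N then zeta R t ^+ j else if j == t :> nat then z else z^-1.

Definition Phi (R : realType) (t : nat) (lam : t.+2.-tuple nat) (z : R[i]) :
  R[i] := (schur R[i] lam).@[Phi_point z].

(* A = {a1 > a2} and B = {b1 > b2}.  First disjunct: two residue classes of
   size two, with residues rA < rB.  Second disjunct: one class {p > q > s} of
   size three, with A = {p, q} and B = {q, s}. *)
Definition is_pair_AB (t : nat) (lam : t.+2.-tuple nat) (a1 a2 b1 b2 : nat) :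
  Prop :=
  (exists rA rB : 'I_t,
     [/\ (rA < rB)%N,
         beta_class lam rA = [:: a1; a2],
         beta_class lam rB = [:: b1; b2] &
         forall r : 'I_t, r != rA -> r != rB -> size (beta_class lam r) = 1%N])
  \/
  (exists (r : 'I_t) (p q s : nat),
     [/\ beta_class lam r = [:: p; q; s],
         forall r' : 'I_t, r' != r -> size (beta_class lam r') = 1%N,
         (a1, a2) = (p, q) &
         (b1, b2) = (q, s)]).

(* Main.v *)
(** The bialternant formula turns the vanishing of [Phi] at [z] (off the finitely
    many zeros of the Vandermonde denominator) into the vanishing of the
    determinant of the matrix [x_i ^ beta_j], i.e. into the existence of a nonzero
    column vector [c], indexed by the beta numbers, in its kernel.  A discrete
    Fourier inversion on the first [t] rows says that [c] sums to zero over each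
    residue class.  Hence an empty class makes the rows dependent, and otherwise
    [c = u (e_a1 - e_a2) + w (e_b1 - e_b2)], in the triple case too.  The rows of
    [z] and [z^-1] give a 2 x 2 system in [u, w] with determinant
    [(z^a1 - z^a2) (z^b1 - z^b2) (z^-(a1+a2) - z^-(b1+b2))] up to sign, which is
    nonzero at [z = 2] unless [a1 + a2 = b1 + b2].  Conversely vanishing at generic
    [z] extends to every nonzero [z], [Phi] being a Laurent polynomial in [z]. *)
Require Import Defs.
From mathcomp Require Import all_boot all_order all_algebra perm.
From mathcomp Require Import complex mpoly.
From mathcomp Require Import reals trigo.
From mathcomp Require Import ring lra zify.

Set Implicit Arguments.
Unset Strict Implicit.
Unset Printing Implicit Defensive.

Import Order.TTheory GRing.Theory Num.Theory.
Local Open Scope ring_scope.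

(** * Primitivity of the root of unity [zeta] *)

Lemma zetaX (R : realType) t k :
  zeta R t ^+ k =
  (cos (2 * pi / t%:R * k%:R) +i* sin (2 * pi / t%:R * k%:R))%C.
Proof.
elim: k => [|k IHk]; first by rewrite mulr0 cos0 sin0 expr0.
rewrite exprS IHk; set u := 2 * pi / t%:R.
have -> : u * k.+1%:R = u + u * k%:R by rewrite -nat1r mulrDr mulr1.
rewrite cosD sinD /zeta -/u.
by apply/eqP; rewrite eq_complex /=; apply/andP; split; apply/eqP; ring.
Qed.

(** For an exponent $0<k<t$ the half angle $h=\pi k/t$ lies in $(0,\pi)$, so $\sin h>0$ and the real
    part $\cos 2h=1-2\sin^2h$ is less than 1. *)
Lemma zeta_prim (R : realType) t : (0 < t)%N -> t.-primitive_root (zeta R t).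
Proof.
move=> t0; rewrite /primitive_root_of_unity t0.
have tR0 : (0 : R) < t%:R by rewrite ltr0n.
apply/forallP => -[k /= kt]; rewrite unity_rootE zetaX.
case: (eqVneq k.+1 t) => [-> | k1t].
  have -> : 2 * pi / t%:R * t%:R = pi *+ 2 :> R.
    by rewrite -mulr_natl; field; rewrite gt_eqF.
  rewrite cos2pi sin2pi.
  by rewrite eqxx.
have k1t' : (k.+1 < t)%N by rewrite ltn_neqAle k1t.
pose h : R := pi * k.+1%:R / t%:R.
have -> : 2 * pi / t%:R * k.+1%:R = h *+ 2 :> R.
  by rewrite /h -mulr_natr; field; rewrite gt_eqF.
have h_gt0 : 0 < sin h.
  apply: sin_gt0_pi; rewrite /h divr_gt0 ?mulr_gt0 ?pi_gt0 ?ltr0n //=.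
  by rewrite ltr_pdivrMr // ltr_pM2l ?pi_gt0 // ltr_nat.
rewrite eqbF_neg eq_complex /= cos_mulr2n; apply/negP => /andP[/eqP e _].
have := cos2Dsin2 h; have : 0 < sin h ^+ 2 by rewrite exprn_gt0.
lra.
Qed.

(** * Evaluated alternants: nonvanishing and kernel vectors *)

Lemma alternant_eval (F : idomainType) n (x : 'I_n -> F) (b : 'I_n -> nat) :
  (alternant F b).@[x] = \det (\matrix_(i, j) x i ^+ b j).
Proof.
rewrite /alternant -det_map_mx; congr (\det _); apply/matrixP => i j.
by rewrite !mxE rmorphXn /= mevalXU.
Qed.

Lemma det_staircase_neq0 (F : idomainType) n (x : 'I_n -> F) :
  injective x -> \det (\matrix_(i, j) x i ^+ staircase j) != 0.
Proof.
move=> xI; pose a : 'rV[F]_n := \row_i x i.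
have -> : \matrix_(i < n, j < n) x i ^+ staircase j =
         col_perm (perm rev_ord_inj) (Vandermonde n a)^T.
  by apply/matrixP => i j; rewrite !mxE permE.
rewrite col_permE det_mulmx det_tr det_perm det_Vandermonde.
rewrite mulf_neq0 ?signr_eq0 //.
apply/prodf_neq0 => i _; apply/prodf_neq0 => j ltij; rewrite !mxE subr_eq0.
by apply/eqP => /xI e; rewrite e ltnn in ltij.
Qed.

(** The kernel vector is a function of the exponent [b j] rather than of the index [j], so that it
    can be summed over residue classes of exponents. Injectivity of [b] makes the two indexings
    equivalent. *)
Lemma det_powers0P (F : fieldType) n (x : 'I_n -> F) (b : 'I_n -> nat) :
  injective b ->
  reflect (exists2 c : nat -> F, exists j, c (b j) != 0 &
             forall i, \sum_j c (b j) * x i ^+ b j = 0)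
          (\det (\matrix_(i, j) x i ^+ b j) == 0).
Proof.
move=> bI; rewrite -det_tr; apply: (iffP det0P) => [[v v0 vM]|[c [j cj] cM]].
  pose c m := \sum_(j | b j == m) v 0 j.
  have cE j : c (b j) = v 0 j.
    by rewrite /c (big_pred1 j) // => i; rewrite (inj_eq bI).
  exists c => [|i].
    have /rV0Pn[j vj] := v0; by exists j; rewrite cE.
  move/rowP/(_ i): vM; rewrite !mxE => vM; rewrite -[RHS]vM.
  by apply: eq_bigr => j _; rewrite !mxE cE.
exists (\row_j c (b j)); first by apply/rV0Pn; exists j; rewrite mxE.
by apply/rowP => i; rewrite !mxE -[RHS](cM i); apply: eq_bigr => k _; rewrite !mxE.
Qed.

(** * Beta numbers sorted into residue classes *)

Lemma beta_ltn n (lam : n.-tuple nat) (i j : 'I_n) :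
  sorted geq lam -> (i < j)%N -> (beta lam j < beta lam i)%N.
Proof.
move=> lamS ij; rewrite /beta !(tnth_nth 0%N).
have ge_tr : transitive geq by move=> y x z /= xy yz; exact: leq_trans xy.
have := sorted_leq_nth ge_tr (leqnn : reflexive geq) 0%N lamS.
move=> /(_ i j); rewrite !inE size_tuple !ltn_ord => /(_ isT isT (ltnW ij)) /=.
have := ltn_ord j; lia.
Qed.

Lemma beta_inj n (lam : n.-tuple nat) : sorted geq lam -> injective (beta lam).
Proof.
move=> lamS i j e; apply/val_inj.
by case: (ltngtP i j) => // /(beta_ltn lamS); rewrite e ltnn.
Qed.

Lemma uniq_beta_class t n (lam : n.-tuple nat) (r : 'I_t) :
  sorted geq lam -> uniq (beta_class lam r).
Proof.
move=> lamS; apply: filter_uniq.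
by rewrite map_inj_uniq ?enum_uniq //; apply: beta_inj.
Qed.

Lemma mem_beta_class t n (lam : n.-tuple nat) (r : 'I_t) b :
  b \in beta_class lam r -> (b %% t)%N = r /\ exists j, b = beta lam j.
Proof.
by rewrite mem_filter => /andP[/eqP -> /mapP[j _ ->]]; split => //; exists j.
Qed.

Lemma beta_in_class t n (lam : n.-tuple nat) (r : 'I_t) j :
  (beta lam j %% t)%N = r -> beta lam j \in beta_class lam r.
Proof. by move=> e; rewrite mem_filter e eqxx map_f ?mem_enum. Qed.

Lemma big_beta_class (V : nmodType) t n (lam : n.-tuple nat) (f : nat -> V) :
  (0 < t)%N ->
  \sum_j f (beta lam j) = \sum_(r < t) \sum_(b <- beta_class lam r) f b.
Proof.
move=> t0; under [RHS]eq_bigr do rewrite big_filter big_map big_enum_cond /=.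
rewrite (exchange_big_dep xpredT) //=; apply: eq_bigr => j _.
by rewrite (big_pred1 (Ordinal (ltn_pmod (beta lam j) t0))).
Qed.

(** * Fourier inversion and the rows of the alternant *)

(** The polynomial $\sum_r s_rX^r$ has degree less than $t$ and vanishes at the $t$ distinct powers
    of $x$. *)
Lemma fourier_inj (F : fieldType) t (x : F) (s : 'I_t -> F) :
  t.-primitive_root x -> (forall i : 'I_t, \sum_(r < t) x ^+ (i * r) * s r = 0) ->
  forall r, s r = 0.
Proof.
move=> px s0.
pose p : {poly F} := \sum_(r < t) s r *: 'X^r.
suff p0 : p = 0.
  move=> r; have := coef0 F r; rewrite -p0 coef_sum (bigD1 r) //= big1.
    by rewrite coefZ coefXn eqxx mulr1 addr0.
  by move=> k kr; rewrite coefZ coefXn val_eqE eq_sym (negbTE kr) mulr0.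
apply: (@roots_geq_poly_eq0 _ _ [seq x ^+ i | i <- iota 0 t]).
- apply/allP => _ /mapP[i + ->]; rewrite mem_iota /= => it.
  apply/rootP; rewrite horner_sum -[RHS](s0 (Ordinal it)).
  by apply: eq_bigr => r _; rewrite hornerZ hornerXn -exprM mulrC.
- rewrite map_inj_in_uniq ?iota_uniq // => i j.
  rewrite !mem_iota /= => it jt /eqP; rewrite (eq_prim_root_expr px).
  by rewrite !modn_small // => /eqP.
rewrite size_map size_iota; apply: (leq_trans (size_sum _ _ _)).
by apply/bigmax_leqP => r _; rewrite (leq_trans (size_scale_leq _ _)) ?size_polyXn.
Qed.

(** Since $\zeta^{ib}$ depends only on $b$ modulo $t$, the first $t$ rows applied to [c] are the
    discrete Fourier transform of its class sums, which [fourier_inj] inverts. *)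
Lemma alternant0P (R : realType) t (lam : t.+2.-tuple nat) (z : R[i]) :
  (0 < t)%N -> sorted geq lam ->
  (\det (\matrix_(i, j) Phi_point z i ^+ beta lam j) = 0) <->
  exists2 c : nat -> R[i], exists j, c (beta lam j) != 0 &
    [/\ forall r : 'I_t, \sum_(b <- beta_class lam r) c b = 0,
        \sum_(r < t) \sum_(b <- beta_class lam r) c b * z ^+ b = 0 &
        \sum_(r < t) \sum_(b <- beta_class lam r) c b * z^-1 ^+ b = 0].
Proof.
move=> t0 lamS; have pz := zeta_prim R t0.
have rowE (c : nat -> R[i]) x : \sum_j c (beta lam j) * x ^+ beta lam j =
    \sum_(r < t) \sum_(b <- beta_class lam r) c b * x ^+ b.
  exact: (big_beta_class lam (fun b => c b * x ^+ b)).
have zetaE (c : nat -> R[i]) i :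
    \sum_(r < t) \sum_(b <- beta_class lam r) c b * (zeta R t ^+ i) ^+ b =
    \sum_(r < t) zeta R t ^+ (i * r) * \sum_(b <- beta_class lam r) c b.
  apply: eq_bigr => r _; rewrite mulr_sumr; apply: eq_big_seq => b.
  case/mem_beta_class => br _; rewrite mulrC -exprM; congr (_ * _).
  by apply/eqP; rewrite (eq_prim_root_expr pz) -br modnMmr.
have ltS i : (i < t -> i < t.+2)%N by lia.
have t1 : (t < t.+2)%N by [].
have t2 : (t.+1 < t.+2)%N by [].
have P0 i (it : (i < t)%N) : Phi_point z (Ordinal (ltS i it)) = zeta R t ^+ i.
  by rewrite /Phi_point /= it.
have P1 : Phi_point z (Ordinal t1) = z by rewrite /Phi_point /= ltnn eqxx.
have P2 : Phi_point z (Ordinal t2) = z^-1.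
  by rewrite /Phi_point /= ltnNge leqnSn /= gtn_eqF.
split=> [/eqP/(det_powers0P (Phi_point z) (beta_inj lamS))[c c0 cM]|
         [c c0 [cC cz cz']]].
  exists c => //; split.
  - apply: (fourier_inj pz) => i.
    by rewrite -zetaE -rowE -(P0 i (ltn_ord i)) cM.
  - by rewrite -rowE -{1}P1 cM.
  - by rewrite -rowE -{1}P2 cM.
apply/eqP/(det_powers0P _ (beta_inj lamS)); exists c => // i.
rewrite rowE /Phi_point; case: ifP => it.
  by rewrite zetaE big1 // => r _; rewrite cC mulr0.
by case: ifP.
Qed.

Lemma alternant_empty (R : realType) t (lam : t.+2.-tuple nat) (z : R[i])
    (r : 'I_t) :
  beta_class lam r = [::] ->
  \det (\matrix_(i, j) Phi_point z i ^+ beta lam j) = 0.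
Proof.
move=> r0; have t0 : (0 < t)%N := leq_ltn_trans (leq0n r) (ltn_ord r).
have pz := zeta_prim R t0.
pose w (i : 'I_t.+2) : R[i] := if (i < t)%N then zeta R t ^+ (i * (t - r)) else 0.
(* Row [i] weighted by [zeta ^ (- i r)]: column [j] then sums to [t] if
   [beta_j] is in class [r], and to 0 otherwise. *)
apply/eqP/det0P; exists (\row_i w i).
  by apply/rV0Pn; exists ord0; rewrite mxE /w t0 mul0n expr0 oner_eq0.
apply/rowP => j; rewrite !mxE.
under eq_bigr do rewrite !mxE.
rewrite !big_ord_recr /= /w /= ltnn ltnNge leqnSn /= !mul0r !addr0.
(* The weighted column sum is geometric with ratio [x], where [t - r] stands for $-r$ modulo $t$.
   Here $x^t=1$, and $x=1$ would put [beta lam j] in the empty class [r]. *)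
set x := zeta R t ^+ (beta lam j + (t - r)).
have xE (i : 'I_t) : true ->
    (if (i < t)%N then zeta R t ^+ (i * (t - r)) else 0) *
      @Phi_point R t z (widen_ord (leqnSn t.+1) (widen_ord (leqnSn t) i))
        ^+ beta lam j = x ^+ i.
  move=> _; rewrite /Phi_point /= ltn_ord -!exprM -exprD; congr (_ ^+ _); lia.
rewrite (eq_bigr _ xE).
have x1 : x - 1 != 0.
  rewrite subr_eq0 -(prim_order_dvd pz); apply/negP => dvd.
  have := @beta_in_class t _ lam r j; rewrite r0 in_nil => F.
  suff /F : (beta lam j %% t)%N = r by [].
  have rt := ltn_ord r.
  have e : (beta lam j + (t - r) + r = beta lam j + t)%N by lia.
  by rewrite -(modnDr (beta lam j) t) -e -modnDml (eqP dvd) add0n modn_small.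
apply: (mulfI x1); rewrite -subrX1 mulr0 -exprM mulnC exprM.
by rewrite (prim_expr_order pz) expr1n subrr.
Qed.

(** * From [Phi] to the alternant at generic points *)

(** As $z^t\ne1$, neither $z$ nor $z^{-1}$ is a power of [zeta]; $z^2\ne1$ separates $z$ from
    $z^{-1}$. *)
Lemma Phi_point_inj (R : realType) t (z : R[i]) :
  z != 0 -> z ^+ t != 1 -> z ^+ 2 != 1 -> (0 < t)%N ->
  injective (@Phi_point R t z).
Proof.
move=> z0 zt z2 t0; have pz := zeta_prim R t0.
have zX k : (zeta R t ^+ k) ^+ t = 1.
  by rewrite -exprM mulnC exprM (prim_expr_order pz) expr1n.
have ne k : zeta R t ^+ k <> z by move=> e; rewrite -e zX eqxx in zt.
have ne' k : zeta R t ^+ k <> z^-1.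
  by move=> e; rewrite -[z]invrK -e exprVn zX invr1 eqxx in zt.
have zz : z <> z^-1 by move=> e; rewrite expr2 {2}e mulfV ?eqxx in z2.
move=> i j; rewrite /Phi_point.
have := ltn_ord i; have := ltn_ord j.
have [jt _|jt jt2] := ltnP j t; have [it _|it it2] := ltnP i t => /=.
- move=> /eqP; rewrite (eq_prim_root_expr pz) !modn_small // => /eqP.
  exact: val_inj.
- by case: ifP => _ e; [case: (ne j) | case: (ne' j)].
- by case: ifP => _ e; [case: (ne i) | case: (ne' i)].
- case: eqP => [ie|ie]; case: eqP => [je|je] e; apply/val_inj => /=.
  + by rewrite ie je.
  + by case: zz.
  + by case: zz.
  + lia.
Qed.

Lemma Phi_eq0 (R : realType) t (lam : t.+2.-tuple nat) (z : R[i]) :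
  (0 < t)%N -> z != 0 -> z ^+ t != 1 -> z ^+ 2 != 1 ->
  (Phi lam z == 0) = (\det (\matrix_(i, j) Phi_point z i ^+ beta lam j) == 0).
Proof.
move=> t0 z0 zt z2.
rewrite -alternant_eval -schurE mevalM alternant_eval mulf_eq0.
by rewrite (negbTE (det_staircase_neq0 (Phi_point_inj z0 zt z2 t0))) orbF.
Qed.

(** * Laurent polynomials and extension from generic points *)

(** Laurent polynomial functions, encoded by clearing the pole at 0. The value at 0 is left free,
    because $0^{-1}=0$ there is only a convention. *)
Definition is_laurent (F : fieldType) (f : F -> F) :=
  exists (M : nat) (Q : {poly F}), forall z, z != 0 -> f z * z ^+ M = Q.[z].

Lemma is_laurentM (F : fieldType) (f g : F -> F) :
  is_laurent f -> is_laurent g -> is_laurent (fun z => f z * g z).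
Proof.
move=> [M [Q fE]] [N [P gE]]; exists (M + N)%N, (Q * P) => z z0.
by rewrite hornerM -fE // -gE // exprD mulrACA.
Qed.

Lemma is_laurentD (F : fieldType) (f g : F -> F) :
  is_laurent f -> is_laurent g -> is_laurent (fun z => f z + g z).
Proof.
move=> [M [Q fE]] [N [P gE]]; exists (M + N)%N, (Q * 'X^N + P * 'X^M) => z z0.
rewrite hornerD !hornerM !hornerXn -fE // -gE // exprD; ring.
Qed.

Lemma is_laurent_cst (F : fieldType) (a : F) : is_laurent (fun _ => a).
Proof. by exists 0%N, a%:P => z _; rewrite hornerC mulr1. Qed.

(** Each coordinate of [Phi_point] is a constant, $z$ or $z^{-1}$; nested inductions over the
    monomials of the Schur polynomial and over the variables do the rest. *)
Lemma Phi_laurent (R : realType) t (lam : t.+2.-tuple nat) :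
  is_laurent (@Phi R t lam).
Proof.
pose s := schur R[i] lam.
suff [M [Q e]] : is_laurent (fun z : R[i] => \sum_(m <- msupp s)
    s@_m * \prod_i Phi_point z i ^+ m i).
  by exists M, Q => z z0; rewrite -e // -mevalE.
elim: (msupp s) => [|m r [M [Q e]]].
  exists 0%N, 0 => z _; by rewrite big_nil mul0r horner0.
suff [M' [Q' e']] : is_laurent (fun z : R[i] =>
    s@_m * (\prod_i Phi_point z i ^+ m i) +
    (\sum_(m <- r) s@_m * \prod_i Phi_point z i ^+ m i)).
  by exists M', Q' => z z0; rewrite -e' // big_cons.
apply: is_laurentD; last by exists M, Q.
apply: is_laurentM; first exact: is_laurent_cst.
elim: (index_enum _) => [|i I [N [P eI]]].
  by exists 0%N, 1 => z _; rewrite big_nil hornerC mulr1.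
suff [M' [Q' e']] : is_laurent (fun z : R[i] => Phi_point z i ^+ m i *
    (\prod_(i <- I) Phi_point z i ^+ m i)).
  by exists M', Q' => z z0; rewrite -e' // big_cons.
apply: is_laurentM; last by exists N, P.
rewrite /Phi_point; case: (i < t)%N; first exact: is_laurent_cst.
case: (i == t :> nat).
  by exists 0%N, 'X^(m i) => z _; rewrite hornerXn mulr1.
exists (m i), 1 => z z0; rewrite hornerC -exprMn mulVf // expr1n //.
Qed.

(** If the numerator $Q$ were nonzero, $X\,G\,Q$ would have a non-root $z$ in the algebraically
    closed field. The factor $X$ makes $z\ne0$ and $G$ makes $z$ generic, so $f(z)=0$, against
    $Q(z)\ne0$. *)
Lemma is_laurent_eq0 (F : closedFieldType) (f : F -> F) (G : {poly F}) :
  is_laurent f -> G != 0 -> (forall z, z != 0 -> ~~ root G z -> f z = 0) ->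
  forall z, z != 0 -> f z = 0.
Proof.
move=> [M [Q fE]] G0 f0; suff Q0 : Q = 0.
  move=> z z0; apply/eqP; have := fE z z0; rewrite Q0 horner0 => /eqP.
  by rewrite mulf_eq0 expf_eq0 (negbTE z0) andbF orbF.
apply/eqP; apply: contraT => Qn0.
have /closed_nonrootP[z] : 'X * G * Q != 0 by rewrite !mulf_neq0 ?polyX_eq0.
rewrite !rootM !negb_or rootX => /andP[/andP[z0 Gz]] /negP[].
by apply/rootP; rewrite -fE // f0 // mul0r.
Qed.

(** * Class sizes when no class is empty *)

(** The excesses [d r] of the sizes over 1 add up to 2, hence are a single 2 or two 1s. *)
Lemma sum_deg2_cases t (s : 'I_t -> nat) :
  (forall r, 0 < s r)%N -> (\sum_r s r = t.+2)%N ->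
  (exists2 r, s r = 3%N & forall r', r' != r -> s r' = 1%N) \/
  (exists rA rB : 'I_t, [/\ (rA < rB)%N, s rA = 2%N, s rB = 2%N &
     forall r, r != rA -> r != rB -> s r = 1%N]).
Proof.
move=> s0 sE; pose d r := (s r).-1.
have sd r : s r = (d r).+1 by rewrite /d prednK.
have dE : (\sum_r d r = 2)%N.
  apply: (@addnI t); rewrite addn2 -sE -[X in (X + _)%N]card_ord -sum1_card.
  by rewrite -big_split; apply: eq_bigr => r _; rewrite sd.
have [r r0] : exists r, d r != 0%N.
  apply/existsP; apply: contraPT dE; rewrite negb_exists => /forallP d0.
  by rewrite big1 // => r _; apply/eqP; rewrite -[_ == _]negbK.
move: dE; rewrite (bigD1 r) //=; case E: (d r) r0 => [|[|n]] // _; last first.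
  rewrite !addSn => -[/eqP]; rewrite addn_eq0 sum_nat_eq0.
  case/andP=> /eqP n0 /forall_inP d0.
  left; exists r => [|r' /d0/eqP]; first by rewrite sd E n0.
  by rewrite sd => ->.
rewrite add1n => -[/eqP/sum_nat_eq1[r' [rr' d1 d0]]]; right.
have s1 i : i != r -> i != r' -> s i = 1%N.
  by move=> ir ir'; rewrite sd d0.
have [lt|gt|e] := ltngtP r r'.
- by exists r, r'; rewrite !sd E d1; split.
- by exists r', r; rewrite !sd E d1; split => // i ir' ir; rewrite s1.
- by rewrite (val_inj e) eqxx in rr'.
Qed.

Lemma sum_size_beta_class t n (lam : n.-tuple nat) :
  (0 < t)%N -> (\sum_(r < t) size (beta_class lam r) = n)%N.
Proof.
move=> t0; have := big_beta_class lam (fun _ => 1%N) t0.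
rewrite [LHS]sum1_card card_ord => {2}->.
by apply: eq_bigr => r _; rewrite -sum1_size.
Qed.

Lemma pair_AB_exists t (lam : t.+2.-tuple nat) :
  (0 < t)%N -> (forall r : 'I_t, beta_class lam r <> [::]) ->
  exists a1 a2 b1 b2, is_pair_AB lam a1 a2 b1 b2.
Proof.
move=> t0 ne.
have s0 (r : 'I_t) : (0 < size (beta_class lam r))%N.
  by case: (beta_class lam r) (ne r).
have [[r s3 s1]|[rA [rB [AB]]]] := sum_deg2_cases s0 (sum_size_beta_class lam t0).
  case e: (beta_class lam r) s3 => [|p [|q [|s []]]] // _.
  by exists p, q, q, s; right; exists r, p, q, s.
case eA: (beta_class lam rA) => [|a1 [|a2 []]] // _.
case eB: (beta_class lam rB) => [|b1 [|b2 []]] // _ s1.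
by exists a1, a2, b1, b2; left; exists rA, rB.
Qed.

(** * The two-parameter kernel and necessity of the sum condition *)

Lemma sum_size1_eq0 (V : nmodType) (s : seq nat) (c : nat -> V) :
  size s = 1%N -> \sum_(b <- s) c b = 0 -> {in s, forall b, c b = 0}.
Proof.
by case: s => [|x []] // _; rewrite big_seq1 => cx b; rewrite inE => /eqP->.
Qed.

(** Zero class sums kill [c] on singleton classes and leave two free parameters [u] and [w]. The
    test function [g] is arbitrary so that the result serves both the row of $z$ and that of
    $z^{-1}$. *)
Lemma pair_AB_kernel (F : comNzRingType) t (lam : t.+2.-tuple nat)
    a1 a2 b1 b2 (c : nat -> F) :
  is_pair_AB lam a1 a2 b1 b2 ->
  (forall r : 'I_t, \sum_(b <- beta_class lam r) c b = 0) ->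
  exists u w : F,
    (forall g : nat -> F, \sum_(r < t) \sum_(b <- beta_class lam r) c b * g b =
       u * (g a1 - g a2) + w * (g b1 - g b2)) /\
    (u = 0 -> w = 0 -> forall j, c (beta lam j) = 0).
Proof.
have cls (r0 : 'I_t) j : exists r : 'I_t, beta lam j \in beta_class lam r.
  have t0 : (0 < t)%N := leq_ltn_trans (leq0n r0) (ltn_ord r0).
  by exists (Ordinal (ltn_pmod (beta lam j) t0)); apply: beta_in_class.
move=> AB cC; case: AB => [[rA [rB [AB eA eB s1]]]|
                        [r0 [p [q [s [e s1 [-> ->] [-> ->]]]]]]].
  have BA : rB != rA by rewrite neq_ltn AB orbT.
  have c1 r : r != rA -> r != rB -> {in beta_class lam r, forall b, c b = 0}.
    by move=> rA' rB'; apply: sum_size1_eq0; [apply: s1 | apply: cC].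
  have := cC rA; have := cC rB; rewrite eA eB !big_cons !big_nil !addr0.
  move/eqP; rewrite addrC addr_eq0 => /eqP cb.
  move/eqP; rewrite addrC addr_eq0 => /eqP ca.
  exists (c a1), (c b1); split=> [g | ca1 cb1 j].
    rewrite (bigD1 rA) //= (bigD1 rB) //= [X in _ + (_ + X)]big1 => [|r /andP[rA' rB']].
      by rewrite eA eB !big_cons !big_nil ca cb; ring.
    by apply: big1_seq => b /andP[_ br]; rewrite (c1 r) // mul0r.
  have [r jr] := cls rA j; have [er|rA'] := eqVneq r rA.
    move: jr; rewrite er eA !inE => /orP[]/eqP-> //; by rewrite ca ca1 oppr0.
  have [er|rB'] := eqVneq r rB; last exact: (c1 r).
  move: jr; rewrite er eB !inE => /orP[]/eqP-> //; by rewrite cb cb1 oppr0.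
have c1 r : r != r0 -> {in beta_class lam r, forall b, c b = 0}.
  by move=> rr0; apply: sum_size1_eq0; [apply: s1 | apply: cC].
have := cC r0; rewrite e !big_cons !big_nil !addr0.
rewrite addrA addrC => /eqP; rewrite addr_eq0 => /eqP cs.
(* With $c_s=-(c_p+c_q)$, one has $c=c_p(e_p-e_q)+(c_p+c_q)(e_q-e_s)$. *)
exists (c p), (c p + c q); split=> [g | cp cpq j].
  rewrite (bigD1 r0) //= [X in _ + X]big1 => [|r rr0].
    by rewrite e !big_cons !big_nil cs; ring.
  by apply: big1_seq => b /andP[_ br]; rewrite (c1 r) // mul0r.
have [r jr] := cls r0 j; have [er|rr0] := eqVneq r r0; last exact: (c1 r).
move: jr; rewrite er e !inE => /or3P[]/eqP-> //.
  by move: cpq; rewrite cp add0r.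
by rewrite cs cpq oppr0.
Qed.

(** Multiplying the second equation by $-x_1x_2y_1y_2$ clears denominators; eliminating $w$ then
    gives $u(x_1-x_2)(x_1x_2-y_1y_2)=0$. If $u=0$, the first equation forces $w=0$. *)
Lemma mul_eq_of_kernel (F : fieldType) (u w x1 x2 y1 y2 : F) :
  x1 != 0 -> x2 != 0 -> y1 != 0 -> y2 != 0 -> x1 != x2 -> y1 != y2 ->
  u * (x1 - x2) + w * (y1 - y2) = 0 ->
  u * (x1^-1 - x2^-1) + w * (y1^-1 - y2^-1) = 0 ->
  ~ (u = 0 /\ w = 0) -> x1 * x2 = y1 * y2.
Proof.
move=> x1n x2n y1n y2n xn yn e1 e2 uw.
have xd : x1 - x2 != 0 by rewrite subr_eq0.
have yd : y1 - y2 != 0 by rewrite subr_eq0.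
have e3 : u * (x1 - x2) * (y1 * y2) + w * (y1 - y2) * (x1 * x2) = 0.
  transitivity (- (x1 * x2 * y1 * y2) *
      (u * (x1^-1 - x2^-1) + w * (y1^-1 - y2^-1))); last by rewrite e2 mulr0.
  by field; rewrite x1n x2n y1n y2n.
have e4 : u * (x1 - x2) * (x1 * x2 - y1 * y2) = 0.
  transitivity ((u * (x1 - x2) + w * (y1 - y2)) * (x1 * x2) -
    (u * (x1 - x2) * (y1 * y2) + w * (y1 - y2) * (x1 * x2))); first by ring.
  by rewrite e1 e3 mul0r subr0.
move/eqP: e4; rewrite !mulf_eq0 (negbTE xd) orbF subr_eq0 => /orP[/eqP u0|/eqP//].
case: uw; split=> //; move/eqP: e1; rewrite u0 mul0r add0r mulf_eq0 (negbTE yd).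
by rewrite orbF => /eqP.
Qed.

Lemma pair_AB_neq t (lam : t.+2.-tuple nat) a1 a2 b1 b2 :
  sorted geq lam -> is_pair_AB lam a1 a2 b1 b2 -> a1 != a2 /\ b1 != b2.
Proof.
move=> lamS [[rA [rB [_ eA eB _]]]|[r [p [q [s [e _ [-> ->] [-> ->]]]]]]].
  have := uniq_beta_class rA lamS; have := uniq_beta_class rB lamS.
  by rewrite eA eB /= !inE !andbT.
have := uniq_beta_class r lamS; rewrite e /= !inE negb_or.
by case/and3P=> /andP[pq _] qs _.
Qed.

Lemma pair_AB_sum_eq (R : realType) t (lam : t.+2.-tuple nat) a1 a2 b1 b2 :
  (0 < t)%N -> sorted geq lam -> is_pair_AB lam a1 a2 b1 b2 ->
  Phi lam (2 : R[i]) = 0 -> (a1 + a2 = b1 + b2)%N.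
Proof.
(* The powers of 2 are pairwise distinct: thus 2 is a generic point, and $2^{a_1+a_2}=2^{b_1+b_2}$
   gives equality of the exponents. *)
move=> t0 lamS AB; pose z : R[i] := 2.
have z0 : z != 0 by rewrite pnatr_eq0.
have zI : injective (GRing.exp z) by apply: ieexprIn; rewrite ?ltr0n ?pnatr_eq1.
have zN m n : m != n -> z ^+ m != z ^+ n by apply: contraNneq => /zI ->.
have z1 k : (0 < k)%N -> z ^+ k != 1.
  by move=> k0; rewrite -(expr0 z) zN // -lt0n.
move/eqP; rewrite Phi_eq0 ?z1 // => /eqP/(alternant0P z t0 lamS).
case=> c [j cj] [cC cz cz'].
have [u [w [uwE uw0]]] := pair_AB_kernel AB cC.
rewrite (uwE (fun b => z ^+ b)) in cz; rewrite (uwE (fun b => z^-1 ^+ b)) in cz'.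
rewrite !exprVn in cz'.
have [aN bN] := pair_AB_neq lamS AB.
apply: zI; rewrite !exprD.
apply: (mul_eq_of_kernel _ _ _ _ _ _ cz cz'); rewrite ?expf_neq0 ?zN //.
by case=> u0 v0; rewrite uw0 ?eqxx in cj.
Qed.

(** Vanishing at 2 would give $p+q=q+s$, hence $p=s$, although the elements of a class are
    distinct. *)
Lemma triple_Phi_neq0 (R : realType) t (lam : t.+2.-tuple nat) (r : 'I_t) :
  sorted geq lam -> size (beta_class lam r) = 3%N ->
  (forall r' : 'I_t, r' != r -> size (beta_class lam r') = 1%N) ->
  Phi lam (2 : R[i]) != 0.
Proof.
move=> lamS s3 s1; have t0 : (0 < t)%N := leq_ltn_trans (leq0n r) (ltn_ord r).
case e: (beta_class lam r) s3 => [|p [|q [|s []]]] // _.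
have AB : is_pair_AB lam p q q s by right; exists r, p, q, s.
apply/eqP => /(pair_AB_sum_eq t0 lamS AB) sE.
have := uniq_beta_class r lamS; rewrite e /= !inE negb_or.
by case/andP=> /andP[_ /eqP[]]; lia.
Qed.

(** * Sufficiency: an explicit kernel vector *)

Lemma alternant_pair_AB0 (R : realType) t (lam : t.+2.-tuple nat)
    a1 a2 b1 b2 (z : R[i]) :
  sorted geq lam -> is_pair_AB lam a1 a2 b1 b2 -> (a1 + a2 = b1 + b2)%N ->
  z != 0 -> z ^+ a1 != z ^+ a2 ->
  \det (\matrix_(i, j) Phi_point z i ^+ beta lam j) = 0.
Proof.
move=> lamS AB sE z0 za; have [aN bN] := pair_AB_neq lamS AB.
case: AB => [[rA [rB [AB eA eB s1]]]|[r [p [q [s [e _ [ap aq] [bq bs]]]]]]];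
  last first.
  (* In the triple case the sum condition reads $p+q=q+s$, which is impossible. *)
  have := uniq_beta_class r lamS; rewrite e /= !inE negb_or.
  by case/andP=> /andP[_ /eqP[]]; lia.
have t0 : (0 < t)%N := leq_ltn_trans (leq0n rA) (ltn_ord rA).
have BA : rB != rA by rewrite neq_ltn AB orbT.
have [a1r [i _]] : (a1 %% t)%N = rA /\ exists j, a1 = beta lam j.
  by apply: mem_beta_class; rewrite eA inE eqxx.
have [a2r _] : (a2 %% t)%N = rA /\ exists j, a2 = beta lam j.
  by apply: mem_beta_class; rewrite eA !inE eqxx orbT.
have [b1r [j b1E]] : (b1 %% t)%N = rB /\ exists j, b1 = beta lam j.
  by apply: mem_beta_class; rewrite eB inE eqxx.
have [b2r _] : (b2 %% t)%N = rB /\ exists j, b2 = beta lam j.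
  by apply: mem_beta_class; rewrite eB !inE eqxx orbT.
(* This choice solves the equation of the row of $z$. It also solves that of $z^{-1}$, because
   $z^{a_1+a_2}=z^{b_1+b_2}$. The hypothesis [za] says that $w\ne0$. *)
pose u := z ^+ b1 - z ^+ b2; pose w := z ^+ a2 - z ^+ a1.
pose c m : R[i] := u * (m == a1)%:R - u * (m == a2)%:R +
                   w * (m == b1)%:R - w * (m == b2)%:R.
have ab x y : (x %% t)%N = rA -> (y %% t)%N = rB -> (x == y) = false.
  move=> xA yB; apply/negP => /eqP xy; case/negP: BA; apply/eqP/val_inj.
  by rewrite /= -xA -yB xy.
have ba x y : (x %% t)%N = rB -> (y %% t)%N = rA -> (x == y) = false.
  by move=> xB yA; rewrite eq_sym ab.
have [a12 b12] := (negbTE aN, negbTE bN).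
have ca1 : c a1 = u by rewrite /c eqxx a12 !ab //= ?mulr0n ?mulr1n; ring.
have ca2 : c a2 = - u by rewrite /c eqxx eq_sym a12 !ab //= ?mulr0n ?mulr1n; ring.
have cb1 : c b1 = w by rewrite /c eqxx b12 !ba //= ?mulr0n ?mulr1n; ring.
have cb2 : c b2 = - w by rewrite /c eqxx [b2 == b1]eq_sym b12 !ba //= ?mulr0n ?mulr1n; ring.
have c0 (r : 'I_t) : r != rA -> r != rB -> {in beta_class lam r, forall b, c b = 0}.
  move=> rA' rB' b /mem_beta_class[br _].
  have ne y (s : 'I_t) : r != s -> (y %% t)%N = s -> (b == y) = false.
    move=> rs ys; apply/negP => /eqP yb; case/negP: rs; apply/eqP/val_inj.
    by rewrite /= -ys -br yb.
  by rewrite /c (ne a1 rA) ?(ne a2 rA) ?(ne b1 rB) ?(ne b2 rB) //= mulr0n; ring.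
have gE (g : nat -> R[i]) : \sum_(r < t) \sum_(b <- beta_class lam r) c b * g b =
    u * (g a1 - g a2) + w * (g b1 - g b2).
  rewrite (bigD1 rA) //= (bigD1 rB) //= [X in _ + (_ + X)]big1 => [|r /andP[rA' rB']].
    by rewrite eA eB !big_cons !big_nil ca1 ca2 cb1 cb2; ring.
  by apply: big1_seq => b /andP[_ br]; rewrite (c0 r) // mul0r.
apply/(alternant0P z t0 lamS); exists c.
  by exists j; rewrite -b1E cb1 subr_eq0 eq_sym.
split=> [r||].
- have [->|rA'] := eqVneq r rA.
    by rewrite eA !big_cons big_nil ca1 ca2 addr0 subrr.
  have [->|rB'] := eqVneq r rB.
    by rewrite eB !big_cons big_nil cb1 cb2 addr0 subrr.
  by apply: big1_seq => b /andP[_ br]; rewrite (c0 r).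
- by rewrite gE /u /w; ring.
rewrite gE !exprVn.
have [x1n x2n] : z ^+ a1 != 0 /\ z ^+ a2 != 0 by rewrite !expf_neq0.
have [y1n y2n] : z ^+ b1 != 0 /\ z ^+ b2 != 0 by rewrite !expf_neq0.
have xy : z ^+ a1 * z ^+ a2 = z ^+ b1 * z ^+ b2 by rewrite -!exprD sE.
have V (x y : R[i]) : x != 0 -> y != 0 -> x^-1 - y^-1 = (y - x) / (x * y).
  by move=> xn yn; field; rewrite xn yn.
by rewrite (V _ _ x1n x2n) (V _ _ y1n y2n) xy /u /w; ring.
Qed.

(** The roots of [G], the $t$-th roots of unity and $\pm1$ are the roots of one nonzero polynomial,
    so they can be avoided and then recovered by the Laurent property. *)
Lemma Phi_eq0_generic (R : realType) t (lam : t.+2.-tuple nat)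
    (G : {poly R[i]}) :
  (0 < t)%N -> G != 0 ->
  (forall z : R[i], z != 0 -> ~~ root G z ->
     \det (\matrix_(i, j) Phi_point z i ^+ beta lam j) = 0) ->
  forall z : R[i], z != 0 -> Phi lam z = 0.
Proof.
move=> t0 G0 detG.
apply: (@is_laurent_eq0 R[i] _ (G * ('X^t - 1) * ('X^2 - 1)) (Phi_laurent R lam)).
  by rewrite !mulf_neq0 // monic_neq0 // monicXnsubC.
move=> z z0; rewrite !rootM !negb_or => /andP[/andP[Gz zt] z2].
apply/eqP; rewrite Phi_eq0 ?detG //.
  by move: zt; rewrite /root hornerD hornerN hornerXn hornerC subr_eq0.
by move: z2; rewrite /root hornerD hornerN hornerXn hornerC subr_eq0.
Qed.

Theorem corollary3p2 (R : realType) (t : nat) (lam : t.+2.-tuple nat)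
    (ht : (2 <= t)%N) (hlam : sorted geq lam) :
  ((forall z : R[i], z != 0 -> Phi lam z = 0) <->
     (exists r : 'I_t, beta_class lam r = [::])
     \/ ((forall r : 'I_t, beta_class lam r <> [::])
         /\ exists a1 a2 b1 b2 : nat,
              is_pair_AB lam a1 a2 b1 b2 /\ (a1 + a2 = b1 + b2)%N))
  /\ ((exists r : 'I_t,
         size (beta_class lam r) = 3%N
         /\ forall r' : 'I_t, r' != r -> size (beta_class lam r') = 1%N) ->
      ~ (forall z : R[i], z != 0 -> Phi lam z = 0)).
Proof.
have t0 : (0 < t)%N by apply: ltnW.
have two0 : (2 : R[i]) != 0 by rewrite pnatr_eq0.
split; last first.
  move=> [r [s3 s1]] Phi0.
  by have := @triple_Phi_neq0 R t lam r hlam s3 s1; rewrite Phi0 ?eqxx.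
split=> [Phi0 | [[r re]|[_ [a1 [a2 [b1 [b2 [AB sE]]]]]]]].
- have [/existsP[r /eqP re]|] := boolP [exists r : 'I_t, beta_class lam r == [::]].
    by left; exists r.
  rewrite negb_exists => /forallP ne0.
  have ne (r : 'I_t) : beta_class lam r <> [::] by apply/eqP.
  right; split=> //; have [a1 [a2 [b1 [b2 AB]]]] := pair_AB_exists t0 ne.
  exists a1, a2, b1, b2; split=> //.
  exact: (pair_AB_sum_eq t0 hlam AB (Phi0 2 two0)).
(* With an empty class the determinant vanishes at every [z], so $G=1$ suffices. *)
- apply: (Phi_eq0_generic t0 (oner_neq0 _)) => z _ _.
  exact: alternant_empty re.
have [aN _] := pair_AB_neq hlam AB.
(* The non-roots of this [G] are the points with $z^{a_1}\ne z^{a_2}$, where the explicit kernel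
   vector is nonzero. *)
apply: (Phi_eq0_generic (G := 'X^a1 - 'X^a2) t0) => [|z z0 Gz].
  apply/eqP => /(congr1 (fun p : {poly R[i]} => p`_a1)).
  rewrite coefB !coefXn eqxx (negbTE aN) subr0 coef0 => /eqP.
  by rewrite oner_eq0.
apply: (alternant_pair_AB0 hlam AB sE z0).
by move: Gz; rewrite /root hornerD hornerN !hornerXn subr_eq0.
Qed.
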